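(* There exists a two-qubit computation $U\in U(4)$ such that every circuit of elementary gates implementing $U$ up to global phase contains at least $17$ gates; in particular, it contains at least $15$ one-qubit rotation gates and at least $2$ CNOT gates.
   Context: Two-qubit computations are $4\times4$ unitary matrices with respect to the computational basis $|00\rangle,|01\rangle,|10\rangle,|11\rangle$. The elementary gates are the $4\times 4$ matrices of the following forms: the one-qubit rotations $R_y(\theta)\otimes \mathbf{1}$, $\mathbf{1}\otimes R_y(\theta)$, $R_z(\alpha)\otimes\mathbf{1}$, $\mathbf{1}\otimes R_z(\alpha)$, where $R_y(\theta)=\begin{pmatrix}\cos\theta/2 & \sin\theta/2\\ -\sin\theta/2 & \cos\theta/2\end{pmatrix}$ and $R_z(\alpha)=\mathrm{diag}(e^{-i\alpha/2},e^{i\alpha/2})$ with $\theta,\alpha$ real; and the two CNOT gates, namely the permutation matrix swapping $|10\rangle\leftrightarrow|11\rangle$ and the permutation matrix swapping $|01\rangle\leftrightarrow|11\rangle$. A circuit computes the product of its gate matrices; it implements $U$ up to global phase if this product equals $cU$ for some $c\in\mathbb{C}$ with $|c|=1$. *)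

(* Defs.v *)
From HB Require Import structures.
From mathcomp Require Import all_boot all_order all_algebra.
From mathcomp Require Import reals trigo.
From mathcomp Require Import complex.
Set Implicit Arguments. Unset Strict Implicit. Unset Printing Implicit Defensive.
Import Order.TTheory GRing.Theory Num.Theory.
Local Open Scope ring_scope.

Section Gates.
Variable R : realType.
Local Notation C := (R[i]).

Definition Ry (theta : R) : 'M[C]_2 :=
  \matrix_(i < 2, j < 2)
    (if (i == 0 :> nat) && (j == 0 :> nat) then (Complex (cos (theta / 2)) 0)
     else if (i == 0 :> nat) then (Complex (sin (theta / 2)) 0)
     else if (j == 0 :> nat) then (Complex (- sin (theta / 2)) 0)
     else (Complex (cos (theta / 2)) 0)).

Definition Rz (alpha : R) : 'M[C]_2 :=
  \matrix_(i < 2, j < 2)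
    (if i != j then 0
     else if (i == 0 :> nat) then (Complex (cos (alpha / 2)) (- sin (alpha / 2)))
     else Complex (cos (alpha / 2)) (sin (alpha / 2))).

(* Kronecker products, basis order |00>,|01>,|10>,|11> = indices 0,1,2,3;
   the first tensor factor is the high bit. *)
Definition kron_left (A : 'M[C]_2) : 'M[C]_4 :=
  \matrix_(i < 4, j < 4)
    (if (i %% 2 == j %% 2)%N then A (inord (i %/ 2)) (inord (j %/ 2)) else 0).
Definition kron_right (A : 'M[C]_2) : 'M[C]_4 :=
  \matrix_(i < 4, j < 4)
    (if (i %/ 2 == j %/ 2)%N then A (inord (i %% 2)) (inord (j %% 2)) else 0).

Definition swap_mx (a b : nat) : 'M[C]_4 :=
  \matrix_(i < 4, j < 4)
    (let s := if (i == a :> nat) then b else if (i == b :> nat) then a else (i : nat) in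
     if (s == j)%N then 1 else 0).

Inductive gate :=
  | RyA of R
  | RyB of R
  | RzA of R
  | RzB of R
  | CNOT1
  | CNOT2.

Definition gate_mx (g : gate) : 'M[C]_4 :=
  match g with
  | RyA t => kron_left (Ry t)
  | RyB t => kron_right (Ry t)
  | RzA a => kron_left (Rz a)
  | RzB a => kron_right (Rz a)
  | CNOT1 => swap_mx 2 3
  | CNOT2 => swap_mx 1 3
  end.

Definition is_rotation (g : gate) : bool :=
  match g with RyA _ | RyB _ | RzA _ | RzB _ => true | _ => false end.
Definition is_cnot (g : gate) : bool :=
  match g with CNOT1 | CNOT2 => true | _ => false end.

Definition circuit_mx (c : seq gate) : 'M[C]_4 := foldr (fun g M => gate_mx g *m M) 1%:M c.

Definition unitary4 (U : 'M[C]_4) : Prop :=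
  U *m (map_mx (@conjc R) U)^T = 1%:M.

Definition implements_up_to_phase (c : seq gate) (U : 'M[C]_4) : Prop :=
  exists z : C, `|z| = 1 /\ circuit_mx c = z *: U.

End Gates.

(* Main.v *)
Require Import Defs.
From HB Require Import structures.
From mathcomp Require Import all_boot all_order all_algebra.
From mathcomp Require Import boolp classical_sets cardinality reals trigo complex.
From mathcomp Require Import mpoly zify ring.
From mathcomp Require lebesgue_measure.
Set Implicit Arguments. Unset Strict Implicit. Unset Printing Implicit Defensive.
Import Order.TTheory GRing.Theory Num.Theory.
Local Open Scope ring_scope.

(* Algebraic form of the dimension count [14 + 1 < 16 = dim U(4)]. Up to a scalar, a
   circuit of a given shape with at most 14 rotations is a polynomial in at most 14
   variables, each rotation contributing its phase [exp(it)]. If it is proportional to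
   the Cayley transform [U] of a skew-Hermitian [A], then the 16 real parameters of [A]
   are rational functions of these variables and the scalar, hence satisfy a nonzero
   polynomial relation depending only on the shape. There are countably many shapes,
   so some [A] satisfies none of the relations. A circuit with at most one CNOT is
   (local)(CNOT)(local), where local means [A (x) B], and up to scalars these products
   depend on only [6 + 6] parameters. *)

(** * Real points avoiding countably many polynomial conditions *)

(** Otherwise the interval [0, 1] would be countable and have Lebesgue measure 0 instead of 1. *)
Lemma countable_family_misses_real (R : realType) (I : countType) (f : I -> R) :
  exists x, forall i, f i <> x.
Proof.
apply: contrapT => /forallNP fsurj.
have := lebesgue_measure.lebesgue_measure_itv `[0%R : R, 1%R].
rewrite lebesgue_measure.countable_lebesgue_measure0; last first.
  apply: (@sub_countable _ _ _ (range f)).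
    apply: subset_card_le => x _.
    by have /existsNP[i /contrapT <-] := fsurj x; exists i.
  apply: (@sub_countable _ _ _ [set: I]%classic); last exact: countableP.
  exact: card_image_le.
rewrite /= constructive_ereal.lte_fin ltr01 oppr0 constructive_ereal.adde0 => -[] /eqP.
by rewrite eq_sym oner_eq0.
Qed.

(* Exponent vectors in [{0..D-1}^n]; the head component is the exponent of the
   variable of index [n-1]. *)
Fixpoint expo (D n : nat) : finType :=
  if n is n'.+1 then ('I_D * expo D n')%type else unit.

Fixpoint monomial (A : nzSemiRingType) (D n : nat) (a : nat -> A) : expo D n -> A :=
  match n return expo D n -> A with
  | 0 => fun=> 1
  | n'.+1 => fun t => a n' ^+ t.1 * @monomial A D n' a t.2
  end.
Arguments monomial {A D n}.

Lemma card_expo D n : #|expo D n| = (D ^ n)%N.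
Proof. by elim: n => [|n IH] /=; rewrite ?card_unit // card_prod card_ord IH expnS. Qed.

Lemma eq_monomial (A : nzSemiRingType) D n (a b : nat -> A) (t : expo D n) :
  (forall k, (k < n)%N -> a k = b k) -> monomial a t = monomial b t.
Proof.
elim: n t => [//|n IH] t ab /=.
by rewrite ab // (IH t.2) // => k kn; apply: ab; rewrite ltnW.
Qed.

Lemma eq_monomial_sum (A : nzSemiRingType) D n (c : expo D n -> A) (a b : nat -> A) :
  (forall k, (k < n)%N -> a k = b k) ->
  \sum_t c t * monomial a t = \sum_t c t * monomial b t.
Proof. by move=> ab; apply: eq_bigr => t _; rewrite (eq_monomial t ab). Qed.

(* The coordinates are chosen one at a time: once the first [n] of them leave some
   coefficient of each polynomial nonzero, only countably many values are
   forbidden for the last one. *)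
Lemma generic_real_point (R : realType) (I : countType) (n : nat) (D : I -> nat)
    (c : forall s, expo (D s) n -> R[i]) :
    (forall s, exists t, c s t != 0) ->
  exists a : nat -> R, forall s, \sum_t c s t * monomial (fun k => (a k)%:C%C) t != 0.
Proof.
elim: n c => [|n IH] c cn0.
  exists (fun=> 0) => s; have [[] nz] := cn0 s.
  by rewrite (bigD1 tt) //= big1 ?addr0 ?mulr1 //; case.
(* [k s] is the exponent of the last variable in a term with nonzero coefficient; the induction
   hypothesis keeps the coefficient of that power nonzero. *)
pose k s : 'I_(D s) := (sval (cid (cn0 s))).1.
have kn0 s : exists t, c s (k s, t) != 0.
  by rewrite /k; case: cid => -[i t] /= cit; exists t.
have [a an0] := IH (fun s t => c s (k s, t)) kn0.
pose q s := \poly_(j < D s) (if insub j is Some i then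
   \sum_t c s (i, t) * monomial (fun k => (a k)%:C%C) t else 0).
have qn0 s : q s != 0.
  apply/eqP => /(congr1 (fun p : {poly _} => p`_(k s))).
  rewrite coef_poly ltn_ord coef0 valK => /eqP; exact/negP/an0.
have /choice[rt rtP] s : exists rs : seq R[i], forall x, root (q s) x -> x \in rs.
  have [rs qE] := closed_field_poly_normal (q s).
  by exists rs => x; rewrite qE rootZ ?lead_coef_eq0 // root_prod_XsubC.
(* A real root equals its real part, so it suffices to avoid the real parts of all roots. Indices
   past the end of a root list merely forbid 0 as well. *)
have [x xP] := @countable_family_misses_real R (I * nat)%type
  (fun sj => complex.Re (nth 0 (rt sj.1) sj.2)).
exists (fun j => if j == n then x else a j) => s.
have : ~~ root (q s) x%:C%C.
  apply/negP => /rtP xin; apply: (xP (s, index x%:C%C (rt s))).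
  by rewrite /= nth_index.
apply: contra => /eqP sum0; apply/eqP; rewrite -[RHS]sum0 horner_poly.
transitivity (\sum_(i < D s) \sum_t c s (i, t) *
    monomial (n := n.+1) (fun j => (if j == n then x else a j)%:C%C) (i, t)); last first.
  by rewrite pair_bigA; apply: eq_bigr => -[].
apply: eq_bigr => i _; rewrite valK mulr_suml; apply: eq_bigr => t _.
rewrite /= eqxx -mulrA [X in _ * X]mulrC; congr (_ * (_ * _)).
by apply: eq_monomial => j /ltn_eqF ->.
Qed.

(** * Algebraic dependence of n+1 fractions in n variables *)

(** Since KD + 1 <= (K+1)D for D > 0, any D larger than (K+1)^n works. *)
Lemma exp_affine_lt (K n : nat) :
  exists D, ((K * D).+1 ^ n < D ^ n.+1)%N.
Proof.
have leX a b k : (a <= b -> a ^ k <= b ^ k)%N.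
  by move=> ab; elim: k => // k IH; rewrite !expnS leq_mul.
exists (K.+1 ^ n).+1; set D := (K.+1 ^ n).+1.
apply: (@leq_ltn_trans ((K.+1 * D) ^ n)).
  by apply: leX; rewrite mulSn addnC -addn1 leq_add2l.
by rewrite expnMn expnS ltn_mul2r expn_gt0 ltnSn.
Qed.

Lemma msizeM_leS {n : nat} {F : idomainType} (p q : {mpoly F[n]}) (d e : nat) :
  (msize p <= d.+1 -> msize q <= e.+1 -> msize (p * q) <= (d + e).+1)%N.
Proof.
have [->|p0] := eqVneq p 0; first by rewrite mul0r msize0.
have [->|q0] := eqVneq q 0; first by rewrite mulr0 msize0.
by rewrite msizeM // => pd qe; lia.
Qed.

Lemma msizeX_leS {n : nat} {F : idomainType} (p : {mpoly F[n]}) (d k : nat) :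
  (msize p <= d.+1 -> msize (p ^+ k) <= (k * d).+1)%N.
Proof.
move=> pd; elim: k => [|k IH]; first by rewrite expr0 msize1.
by rewrite exprS mulSn; exact: msizeM_leS.
Qed.

(* [g ^+ (n * D)] times the monomial in the fractions [G k / g]. *)
Fixpoint homog_monomial (A : nzSemiRingType) (D n : nat) (G : nat -> A) (g : A) :
    expo D n -> A :=
  match n return expo D n -> A with
  | 0 => fun=> 1
  | n'.+1 => fun t => G n' ^+ t.1 * g ^+ (D - t.1) * @homog_monomial A D n' G g t.2
  end.
Arguments homog_monomial {A D n}.

Lemma msize_homog_monomial (F : idomainType) (m D n d : nat) (G : nat -> {mpoly F[m]})
    (g : {mpoly F[m]}) (t : expo D n) :
  (forall k, (k < n)%N -> msize (G k) <= d.+1)%N -> (msize g <= d.+1)%N ->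
  (msize (homog_monomial G g t) <= (n * D * d).+1)%N.
Proof.
move=> + gd; elim: n t => [|n IH] t Gd /=; first by rewrite msize1.
rewrite mulSn mulnDl; apply: msizeM_leS; last first.
  by apply: IH => k kn; apply: Gd; rewrite ltnW.
have -> : (D * d = t.1 * d + (D - t.1) * d)%N.
  by rewrite -mulnDl subnKC // ltnW.
by apply: msizeM_leS; apply: msizeX_leS => //; exact: Gd.
Qed.

Lemma meval_homog_monomial (F : fieldType) (m D n : nat) (G : nat -> {mpoly F[m]})
    (g : {mpoly F[m]}) (t : expo D n) (x : 'I_m -> F) :
  g.@[x] != 0 ->
  (homog_monomial G g t).@[x] =
    g.@[x] ^+ (n * D) * monomial (fun k => (G k).@[x] / g.@[x]) t.
Proof.
move=> g0; elim: n t => [|n IH] t /=; first by rewrite meval1 mulr1.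
rewrite !mevalM IH !rmorphXn /= mulSn exprD expr_div_n.
have -> : g.@[x] ^+ D = g.@[x] ^+ t.1 * g.@[x] ^+ (D - t.1).
  by rewrite -exprD subnKC // ltnW.
by field; rewrite expf_neq0.
Qed.

(* Dimension count: the [D ^ n.+1] polynomials [homog_monomial G g t] have degree
   [O(D)] in [n] variables, so they are linearly dependent for large [D]. *)
Lemma algebraic_dependence (F : fieldType) (n : nat) (G : nat -> {mpoly F[n]})
    (g : {mpoly F[n]}) :
  exists D (c : expo D n.+1 -> F), (exists t, c t != 0) /\
    forall x, g.@[x] != 0 ->
      \sum_t c t * monomial (fun k => (G k).@[x] / g.@[x]) t = 0.
Proof.
pose d := maxn (msize g) (\max_(k < n.+1) msize (G k)).
have gd : (msize g <= d.+1)%N by rewrite ltnW // ltnS leq_maxl.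
have Gd k : (k < n.+1)%N -> (msize (G k) <= d.+1)%N.
  move=> kn; rewrite ltnW // ltnS leq_max; apply/orP; right.
  exact: (@leq_bigmax _ (fun k : 'I_n.+1 => msize (G k)) (Ordinal kn)).
have [D DP] := exp_affine_lt (n.+1 * d) n.
pose B := (n.+1 * d * D).+1.
pose H (t : expo D n.+1) := homog_monomial G g t.
have HB t : (msize (H t) <= B)%N by rewrite /B mulnAC; exact: msize_homog_monomial.
(* Row t lists the coefficients of [H t] at the exponents in the box {0..B-1}^n. There are more rows
   than columns, so the rows are dependent. *)
pose M : 'M[F]_(#|expo D n.+1|, #|{ffun 'I_n -> 'I_B}|) :=
  \matrix_(i, j) (H (enum_val i))@_[multinom
    ((enum_val j : {ffun 'I_n -> 'I_B}) l : nat) | l < n].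
have : kermx M != 0.
  rewrite kermx_eq0 -row_leq_rank -ltnNge.
  apply: leq_ltn_trans (rank_leq_col M) _.
  by rewrite card_expo card_ffun !card_ord.
case/rowV0Pn => u /sub_kermxP uM0 u0.
exists D, (fun t => u 0 (enum_rank t)); split.
  have [i ui] : exists i, u 0 i != 0.
    by apply/existsP; apply: contraR u0 => /existsPn ui;
       apply/eqP/rowP => i; rewrite mxE; apply/eqP/negPn/ui.
  by exists (enum_val i); rewrite enum_valK.
have sumH0 : \sum_t u 0 (enum_rank t) *: H t = 0.
  apply/mpolyP => m; rewrite mcoeff0 raddf_sum /=.
  (* Monomials of degree at least [B] occur in no [H t]; all others have their exponents in the
     box. *)
  have [mB|Bm] := ltnP (mdeg m) B; last first.
    apply: big1 => t _; rewrite mcoeffZ.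
    by rewrite memN_msupp_eq0 ?mulr0 // msize_mdeg_ge // (leq_trans (HB t)).
  have mlB l : (m l < B)%N.
    by apply: leq_ltn_trans mB; rewrite mdegE (bigD1 l) //= leq_addr.
  have := congr1 (fun v : 'rV_ _ => v 0 (enum_rank [ffun l => Ordinal (mlB l)])) uM0.
  rewrite !mxE => sum0; rewrite -[RHS]sum0.
  rewrite (reindex (@enum_val (expo D n.+1) predT)) /=; last first.
    by apply: onW_bij; exact: enum_val_bij.
  apply: eq_bigr => i _; rewrite mxE enum_valK mcoeffZ; congr (_ * _@__).
  by apply/mnmP => l; rewrite mnmE enum_rankK ffunE.
move=> x gx; apply: (mulfI (expf_neq0 (n.+1 * D) gx)); rewrite mulr0.
transitivity ((\sum_t u 0 (enum_rank t) *: H t).@[x]); last by rewrite sumH0 meval0.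
rewrite raddf_sum mulr_sumr; apply: eq_bigr => t _ /=.
by rewrite mevalZ meval_homog_monomial // mulrCA.
Qed.

(** * Kronecker products of 2 by 2 matrices *)

Definition kron (A : pzSemiRingType) (a b : 'M[A]_2) : 'M[A]_4 :=
  \matrix_(i < 4, j < 4)
    (a (inord (i %/ 2)) (inord (j %/ 2)) * b (inord (i %% 2)) (inord (j %% 2))).
Arguments kron {A}.

Lemma sum_ord4 (A : nmodType) (f : 'I_2 -> 'I_2 -> A) :
  \sum_(k < 4) f (inord (k %/ 2)) (inord (k %% 2)) = \sum_a \sum_b f a b.
Proof.
rewrite !big_ord_recl !big_ord0 !addr0 -!addrA.
by congr (f _ _ + (f _ _ + (f _ _ + f _ _))); apply/val_inj; rewrite /= inordK.
Qed.

Lemma kron_mulmx (A : comPzSemiRingType) (a b c d : 'M[A]_2) :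
  kron a b *m kron c d = kron (a *m c) (b *m d).
Proof.
apply/matrixP => i j; rewrite !mxE.
pose f x y := (a (inord (i %/ 2)) x * c x (inord (j %/ 2))) *
              (b (inord (i %% 2)) y * d y (inord (j %% 2))).
rewrite (eq_bigr (fun k : 'I_4 => f (inord (k %/ 2)) (inord (k %% 2)))); last first.
  by move=> k _; rewrite !mxE /f mulrACA.
by rewrite sum_ord4 mulr_suml; apply: eq_bigr => x _; rewrite mulr_sumr.
Qed.

Lemma map_kron (A B : pzSemiRingType) (f : {rmorphism A -> B}) (a b : 'M[A]_2) :
  map_mx f (kron a b) = kron (map_mx f a) (map_mx f b).
Proof. by apply/matrixP => i j; rewrite !mxE rmorphM. Qed.

Lemma scale_kron (A : comPzRingType) (x y : A) (a b : 'M[A]_2) :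
  kron (x *: a) (y *: b) = (x * y) *: kron a b.
Proof. by apply/matrixP => i j; rewrite !mxE mulrACA. Qed.

Lemma inord_eq2 (m n : nat) :
  (m < 2 -> n < 2 -> (inord m == inord n :> 'I_2) = (m == n))%N.
Proof. by move=> m2 n2; rewrite -val_eqE /= !inordK. Qed.

Lemma kron_leftE (R : realType) (a : 'M[R[i]]_2) : kron_left a = kron a 1%:M.
Proof.
apply/matrixP => i j; rewrite !mxE inord_eq2 ?ltn_mod //.
by case: eqP; rewrite ?mulr1 ?mulr0.
Qed.

Lemma kron_rightE (R : realType) (b : 'M[R[i]]_2) : kron_right b = kron 1%:M b.
Proof.
apply/matrixP => i j; rewrite !mxE inord_eq2 ?ltn_divLR //.
by case: eqP; rewrite ?mul1r ?mul0r.
Qed.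

(** * Families of matrices parametrized up to scalars *)

(* Up to nonzero scalars, [S] lies in the image of a polynomial map in the variables
   of indices [k .. l-1]; the indices are kept explicit so that products use
   disjoint sets of variables. *)
Definition poly_covered {F : fieldType} {p q : nat} (k l : nat) (S : 'M[F]_q -> Prop) :=
  exists N : 'M[{mpoly F[p]}]_q, forall M, S M ->
  exists (x : 'I_p -> F) (s : F), s != 0 /\
    forall y : 'I_p -> F, (forall j : 'I_p, (k <= j < l)%N -> y j = x j) ->
      map_mx (meval y) N = s *: M.
Arguments poly_covered {F} p {q}.

Lemma covered_const (F : fieldType) (p q k : nat) (M0 : 'M[F]_q) :
  poly_covered p k k (fun M => M = M0).
Proof.
exists (map_mx (@mpolyC p F) M0) => M ->; exists (fun=> 0), 1.
split; first exact: oner_neq0.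
by move=> y _; apply/matrixP => i j; rewrite !mxE mevalC mul1r.
Qed.

(** The factors use disjoint blocks of variables, so their parameter points can be glued at index
    [l]; the scalars multiply. *)
Lemma covered_mul (F : fieldType) (p q k l m : nat) (S T : 'M[F]_q -> Prop) :
  (k <= l <= m)%N -> poly_covered p k l S -> poly_covered p l m T ->
  poly_covered p k m (fun M => exists A B, [/\ S A, T B & M = A *m B]).
Proof.
move=> /andP[kl lm] [N NP] [P PP]; exists (N *m P) => _ [A [B [/NP NA /PP PB ->]]].
have [x [s [s0 xP]]] := NA; have [y [t [t0 yP]]] := PB.
exists (fun j : 'I_p => if (j < l)%N then x j else y j), (s * t).
split=> [|z zP]; first by rewrite mulf_neq0.
rewrite map_mxM (xP z) ?(yP z) -?scalemxAl -?scalemxAr ?scalerA //.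
- by move=> j /andP[lj jm]; rewrite zP ?(leq_trans kl lj) // ltnNge lj.
- by move=> j /andP[kj jl]; rewrite zP ?kj ?(leq_trans jl lm) // jl.
Qed.

Lemma covered_kron (F : fieldType) (p k l m : nat) (S T : 'M[F]_2 -> Prop) :
  (k <= l <= m)%N -> poly_covered p k l S -> poly_covered p l m T ->
  poly_covered p k m (fun M => exists A B, [/\ S A, T B & M = kron A B]).
Proof.
move=> /andP[kl lm] [N NP] [P PP]; exists (kron N P) => _ [A [B [/NP NA /PP PB ->]]].
have [x [s [s0 xP]]] := NA; have [y [t [t0 yP]]] := PB.
exists (fun j : 'I_p => if (j < l)%N then x j else y j), (s * t).
split=> [|z zP]; first by rewrite mulf_neq0.
rewrite map_kron (xP z) ?(yP z) ?scale_kron //.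
- by move=> j /andP[lj jm]; rewrite zP ?(leq_trans kl lj) // ltnNge lj.
- by move=> j /andP[kj jl]; rewrite zP ?kj ?(leq_trans jl lm) // jl.
Qed.

Lemma covered_sub (F : fieldType) (p q k l : nat) (S T : 'M[F]_q -> Prop) :
  poly_covered p k l T -> (forall M, S M -> T M) -> poly_covered p k l S.
Proof. by move=> [N NP] ST; exists N => M /ST /NP. Qed.

Lemma ord2_neq0 (i : 'I_2) : i != 0 -> i = 1.
Proof. by move=> i0; apply/val_inj; case: i i0 => -[|[|]]. Qed.

(** Dividing by [M 0 b] leaves three free entries: the other one of the first row and both of the
    second. *)
Lemma covered_row_neq0 (F : fieldType) (p k : nat) (b : 'I_2) :
  (k + 3 <= p.+1)%N -> poly_covered p.+1 k (k + 3) (fun M : 'M[F]_2 => M 0 b != 0).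
Proof.
move=> kp.
exists (\matrix_(i, j) if i == 0 then (if j == b then 1 else 'X_(inord k))
        else 'X_(inord (if j == 0 then k.+1 else k.+2))) => M Mb.
exists (fun l : 'I_p.+1 => if l == k :> nat then M 0 (1 - b) / M 0 b else
        if l == k.+1 :> nat then M 1 0 / M 0 b else M 1 1 / M 0 b), (M 0 b)^-1.
split=> [|y yP]; first by rewrite invr_neq0.
have yk j : (k <= j < k + 3)%N -> y (inord j) = if j == k then M 0 (1 - b) / M 0 b else
        if j == k.+1 then M 1 0 / M 0 b else M 1 1 / M 0 b.
  move=> kjk; have jp : (j < p.+1)%N by lia.
  have jE := inordK jp.
  by rewrite yP; rewrite jE.
apply/matrixP => i j; rewrite !mxE mulrC.
have [->|/ord2_neq0 ->] := eqVneq i 0; last first.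
  rewrite mevalXU yk; last by case: ifP => _; lia.
  have [->|/ord2_neq0 ->] := eqVneq j 0; first by rewrite eqxx gtn_eqF.
  by rewrite gtn_eqF ?gtn_eqF.
have [->|/eqP jb] := eqVneq j b; first by rewrite meval1 divff.
rewrite mevalXU yk ?eqxx; last by lia.
congr (M 0 _ / _); apply/eqP; move/eqP: jb.
by case: b {Mb yP yk} => -[|[|]] //= ?; case: j => -[|[|]].
Qed.

(* [exp(it/2) * Ry t] is affine in [w ^+ 2 = exp(it)]. *)
Lemma covered_Ry (R : realType) (p k : nat) : (k <= p)%N ->
  poly_covered p.+1 k k.+1 (fun M : 'M[R[i]]_2 => exists t, M = Ry t).
Proof.
move=> kp; pose X : {mpoly R[i][p.+1]} := 'X_(inord k).
exists (\matrix_(i, j) if i == j then 2^-1 *: (X + 1)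
   else (-1) ^+ i *: ((2 * 'i%C)^-1 *: (X - 1))) => _ [t ->].
pose c : R[i] := (cos (t / 2))%:C%C; pose s : R[i] := (sin (t / 2))%:C%C.
have cs1 : c ^+ 2 = 1 - s ^+ 2.
  by rewrite -!rmorphXn -(rmorph1 (real_complex R)) -rmorphB cos2sin2.
have i2 : 'i%C ^+ 2 = -1 :> R[i] := sqr_i R.
have i0 : 'i%C != 0 :> R[i] by rewrite -sqrf_eq0 i2 oppr_eq0 oner_eq0.
(* [w] is exp(it/2), so w cos(t/2) = (w^2 + 1)/2 and w sin(t/2) = (w^2 - 1)/(2i). *)
pose w := c + 'i%C * s; exists (fun=> w ^+ 2), w; split.
  apply/eqP => w0; have : (c + 'i%C * s) * (c - 'i%C * s) = 1 by ring: cs1 i2.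
  by rewrite -/w w0 mul0r => /esym/eqP; rewrite oner_eq0.
move=> y yP; have yX : y (inord k) = w ^+ 2 by rewrite yP ?inordK ?leqnn ?ltnSn.
have wc : 2^-1 * (w ^+ 2 + 1) = w * c.
  by rewrite /w; field: cs1 i2.
have ws : (2 * 'i%C)^-1 * (w ^+ 2 - 1) = w * s.
  by rewrite /w; field: cs1 i2.
apply/matrixP => i j; rewrite !mxE; case: eqVneq => [->|ij].
  rewrite mevalZ mevalD meval1 mevalXU yX wc; congr (w * _).
  by case: j => -[|[|]].
rewrite !mevalZ mevalB meval1 mevalXU yX ws.
case: i j ij => -[|[|//]] ip [] [|[|//]] jp //= _.
  by rewrite mul1r.
rewrite expr1 mulN1r -mulrN; congr (_ * _).
by apply/eqP; rewrite eq_complex /= oppr0 !eqxx.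
Qed.

(** With w = exp(it/2), the multiple w [Rz t] is diag(1, w^2). *)
Lemma covered_Rz (R : realType) (p k : nat) : (k <= p)%N ->
  poly_covered p.+1 k k.+1 (fun M : 'M[R[i]]_2 => exists t, M = Rz t).
Proof.
move=> kp; exists (\matrix_(i, j) if i != j then 0 else
    if i == 0 :> nat then 1 else 'X_(inord k)) => _ [t ->].
pose w : R[i] := Complex (cos (t / 2)) (sin (t / 2)).
have ww : w * Complex (cos (t / 2)) (- sin (t / 2)) = 1.
  apply/eqP; rewrite eq_complex /= mulrN opprK -!expr2 cos2Dsin2 eqxx /=.
  by rewrite mulrN mulrC addrC subrr eqxx.
exists (fun=> w ^+ 2), w; split.
  by apply/eqP => w0; move/eqP: ww; rewrite w0 mul0r eq_sym oner_eq0.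
move=> y yP; have yX : y (inord k) = w ^+ 2 by rewrite yP ?inordK ?leqnn ?ltnSn.
apply/matrixP => i j; rewrite !mxE; case: eqVneq => [_|_] /=.
  by case: ifP => _; rewrite ?meval1 ?ww // mevalXU yX.
by rewrite meval0 mulr0.
Qed.

(** * Circuit pieces and their parameter counts *)

(* Rotations [(on the first qubit?, about y?)], the two CNOTs, and the Kronecker
   products [A (x) B] whose first rows are nonzero at columns [a] and [b]: after
   normalizing these entries to 1, such a product has [3 + 3] parameters up to
   scalars. *)
Definition piece_kind := (bool * bool + bool + 'I_2 * 'I_2)%type.

Definition piece {R : realType} (kd : piece_kind) : 'M[R[i]]_4 -> Prop :=
  match kd with
  | inl (inl (true, true)) => fun M => exists t, M = kron_left (Ry t)
  | inl (inl (true, false)) => fun M => exists t, M = kron_left (Rz t)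
  | inl (inl (false, true)) => fun M => exists t, M = kron_right (Ry t)
  | inl (inl (false, false)) => fun M => exists t, M = kron_right (Rz t)
  | inl (inr true) => fun M => M = swap_mx R 2 3
  | inl (inr false) => fun M => M = swap_mx R 1 3
  | inr (a, b) => fun M =>
      exists A B : 'M[R[i]]_2, [/\ A 0 a != 0, B 0 b != 0 & M = kron A B]
  end.

Definition piece_dim (kd : piece_kind) : nat :=
  match kd with inl (inl _) => 1 | inl (inr _) => 0 | inr _ => 6 end.

Fixpoint pieces {R : realType} (w : seq piece_kind) (M : 'M[R[i]]_4) : Prop :=
  if w is kd :: w' then exists P Q, [/\ piece kd P, pieces w' Q & M = P *m Q]
  else M = 1%:M.

Definition pieces_dim (w : seq piece_kind) : nat := sumn (map piece_dim w).

Lemma covered_piece (R : realType) (p k : nat) (kd : piece_kind) :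
  (k + piece_dim kd <= p.+1)%N ->
  poly_covered p.+1 k (k + piece_dim kd) (@piece R kd).
Proof.
have covL S : (k < p.+1)%N -> poly_covered p.+1 k k.+1 S ->
    poly_covered p.+1 k k.+1 (fun M : 'M[R[i]]_4 => exists2 A, S A & M = kron_left A).
  move=> kp Scov; have kl : (k <= k.+1 <= k.+1)%N by rewrite leqnSn leqnn.
  have one := covered_const p.+1 k.+1 (1%:M : 'M[R[i]]_2).
  apply: (covered_sub (covered_kron kl Scov one)) => _ [A SA ->].
  by exists A, 1%:M; rewrite kron_leftE.
have covR S : (k < p.+1)%N -> poly_covered p.+1 k k.+1 S ->
    poly_covered p.+1 k k.+1 (fun M : 'M[R[i]]_4 => exists2 A, S A & M = kron_right A).
  move=> kp Scov; have kl : (k <= k <= k.+1)%N by rewrite leqnn leqnSn.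
  have one := covered_const p.+1 k (1%:M : 'M[R[i]]_2).
  apply: (covered_sub (covered_kron kl one Scov)) => _ [A SA ->].
  by exists 1%:M, A; rewrite kron_rightE.
case: kd => [[[q ax]|b]|[a b]] /=.
- rewrite addn1 => kp; have kp' : (k <= p)%N := kp.
  case: q; case: ax.
  + apply: (covered_sub (covL _ kp (covered_Ry R kp'))) => _ [t ->].
    by exists (Ry t) => //; exists t.
  + apply: (covered_sub (covL _ kp (covered_Rz R kp'))) => _ [t ->].
    by exists (Rz t) => //; exists t.
  + apply: (covered_sub (covR _ kp (covered_Ry R kp'))) => _ [t ->].
    by exists (Ry t) => //; exists t.
  + apply: (covered_sub (covR _ kp (covered_Rz R kp'))) => _ [t ->].
    by exists (Rz t) => //; exists t.
- by rewrite addn0 => _; case: b; exact: covered_const.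
- move=> kp; have kl : (k <= k + 3 <= k + 6)%N by rewrite leq_addr leq_add2l.
  have kp3 : (k + 3 <= p.+1)%N by apply: leq_trans kp; rewrite leq_add2l.
  have kp6 : (k + 3 + 3 <= p.+1)%N by rewrite -addnA.
  have := covered_row_neq0 R[i] b kp6; rewrite -addnA.
  exact: (covered_kron kl (covered_row_neq0 R[i] a kp3)).
Qed.

Lemma covered_pieces (R : realType) (p k : nat) (w : seq piece_kind) :
  (k + pieces_dim w <= p.+1)%N ->
  poly_covered p.+1 k (k + pieces_dim w) (@pieces R w).
Proof.
elim: w k => [|kd w IH] k; first by rewrite addn0 => _; exact: covered_const.
rewrite /pieces_dim /= addnA => kp; apply: covered_mul (IH _ kp); last first.
  by apply: covered_piece; apply: leq_trans kp; rewrite leq_addr.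
by rewrite !leq_addr.
Qed.

(** * The Cayley transform and relations among its parameters *)

Definition cayley {R : realType} (A : 'M[R[i]]_4) : 'M[R[i]]_4 :=
  (1%:M - A) *m invmx (1%:M + A).

(* The general skew-Hermitian matrix: [a_ij - a_ji + i (a_ij + a_ji)] is antisymmetric
   plus [i] times symmetric, with [a_ij] stored at index [4 i + j]; [skew_coord]
   recovers the [a_ij] from the matrix entries without complex conjugation. *)
Definition skew_mx {R : realType} (a : nat -> R) : 'M[R[i]]_4 :=
  \matrix_(i, j) Complex (a (4 * i + j)%N - a (4 * j + i)%N)
                         (a (4 * i + j)%N + a (4 * j + i)%N).

Definition skew_coord {A : comNzRingType} (u : A) (M : 'M[A]_4) (k : nat) : A :=
  (1 + u) * M (inord (k %/ 4)) (inord (k %% 4)) +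
  (1 - u) * M (inord (k %% 4)) (inord (k %/ 4)).

(** The a_ji terms cancel, and (1+i)^2 - (1-i)^2 = 4i. *)
Lemma skew_coordE (R : realType) (a : nat -> R) (k : nat) : (k < 16)%N ->
  skew_coord 'i%C (skew_mx a) k = 4%:R * 'i%C * (a k)%:C%C.
Proof.
move=> k16; have k4 : (k %/ 4 < 4)%N by rewrite ltn_divLR.
have kE : (4 * (k %/ 4) + k %% 4 = k)%N by rewrite mulnC -divn_eq.
have skewE i j : skew_mx a i j = (a (4 * i + j)%N - a (4 * j + i)%N)%:C%C +
    'i%C * (a (4 * i + j)%N + a (4 * j + i)%N)%:C%C.
  by rewrite mxE; exact: (complexE (Complex _ _)).
rewrite /skew_coord !skewE !inordK ?ltn_mod // kE !rmorphB !rmorphD /=.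
by ring: (sqr_i R).
Qed.

(* If [s U = N(x)], then [A = (1 - U) / (1 + U)] equals
   [(s - N(x)) adj(s + N(x)) / det(s + N(x))], so that the 16 real parameters of [A]
   are rational functions of the 14 variables [x] and of [s]. *)
Lemma cayley_relation (R : realType) (S : 'M[R[i]]_4 -> Prop) :
  poly_covered 15 0 14 S ->
  exists D (c : expo D 16 -> R[i]), (exists t, c t != 0) /\
    forall a : nat -> R, 1%:M + skew_mx a \in unitmx -> S (cayley (skew_mx a)) ->
      \sum_t c t * monomial (fun k => (a k)%:C%C) t = 0.
Proof.
(* The covering uses the variables 0..13; the one of index 14 stands for the unknown scalar s. *)
move=> [N NP]; pose X : {mpoly R[i][15]} := 'X_(inord 14).
pose F := (X%:M - N) *m \adj (X%:M + N).
pose G k : {mpoly R[i][15]} := skew_coord ('i%C)%:MP F k.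
(* The factor 4i cancels the one produced by [skew_coord], so that [G k / g] evaluates to a_k. *)
pose g := (4%:R * 'i%C) *: \det (X%:M + N).
have [D [c [c0 cP]]] := algebraic_dependence G g.
exists D, c; split=> // a Au /NP[x [s [s0 xP]]].
pose y (j : 'I_15) := if (j < 14)%N then x j else s.
have yN : map_mx (meval y) N = s *: cayley (skew_mx a).
  by apply: xP => j /= j14; rewrite /y j14.
have yX : map_mx (meval y) (X%:M : 'M_4) = s%:M.
  by rewrite map_scalar_mx /= mevalXU /y inordK.
set A := skew_mx a in Au yN *; set U := cayley A in yN.
have U1 : 1%:M + U = 2 *: invmx (1%:M + A).
  rewrite -{1}(mulmxV Au) /U /cayley -mulmxDl addrACA subrr addr0.
  by rewrite -mulr2n -scaler_nat -scalemxAl mul1mx.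
have U2 : 1%:M - U = 2 *: (A *m invmx (1%:M + A)).
  rewrite -{1}(mulmxV Au) /U /cayley -mulmxBl opprB addrC addrA subrK.
  by rewrite -mulr2n -scaler_nat -scalemxAl.
(* [V] is the value of [X%:M + N] at [y]; as a nonzero multiple of the inverse of 1 + A it is
   invertible. *)
pose V := s%:M + s *: U.
have VE : V = (s * 2) *: invmx (1%:M + A).
  by rewrite /V -[s%:M]scalemx1 -scalerDr U1 scalerA.
have Vdet : \det V != 0.
  rewrite VE detZ mulf_neq0 ?expf_neq0 ?mulf_neq0 ?pnatr_eq0 //.
  by rewrite -unitfE -unitmxE unitmx_inv.
have AV : s%:M - s *: U = A *m V.
  by rewrite VE -scalemxAr -[s%:M]scalemx1 -scalerBr U2 scalerA.
have FE : map_mx (meval y) F = \det V *: A.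
  rewrite map_mxM map_mx_adj map_mxB map_mxD /= yX yN -/V AV -mulmxA mul_mx_adj.
  by rewrite mul_mx_scalar.
have gE : g.@[y] = 4%:R * 'i%C * \det V.
  by rewrite mevalZ -det_map_mx map_mxD /= yX yN.
have u0 : 4%:R * 'i%C != 0 :> R[i].
  by rewrite mulf_neq0 ?pnatr_eq0 // -sqrf_eq0 sqr_i oppr_eq0 oner_eq0.
have g0 : g.@[y] != 0 by rewrite gE mulf_neq0.
rewrite -[RHS](cP y g0); apply: eq_monomial_sum => k k16; apply: (mulIf g0).
rewrite divfK // gE.
have Fij i j : (F i j).@[y] = \det V * A i j.
  by transitivity (map_mx (meval y) F i j); [rewrite [RHS]mxE | rewrite FE [LHS]mxE].
rewrite /G /skew_coord mevalD !mevalM mevalD mevalB !meval1 !mevalC !Fij.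
transitivity (\det V * skew_coord 'i%C A k); last by rewrite /skew_coord; ring.
by rewrite skew_coordE //; ring.
Qed.

Lemma skew_mx_adj (R : realType) (a : nat -> R) :
  (map_mx (@conjc R) (skew_mx a))^T = - skew_mx a.
Proof.
apply/matrixP => i j; rewrite !mxE; apply/eqP; rewrite eq_complex /=.
by rewrite opprB eqxx addrC eqxx.
Qed.

(** If v(1 + A) = 0 with A skew-Hermitian, then v v* = - v v*, hence v v* = 0 and v = 0. *)
Lemma unitmx_skew (R : realType) (a : nat -> R) : 1%:M + skew_mx a \in unitmx.
Proof.
rewrite -row_free_unit -kermx_eq0; apply: contraT => /rowV0Pn[v /sub_kermxP].
rewrite mulmxDr mulmx1 => /eqP; rewrite addr_eq0 => /eqP vA /eqP[].
set v' := (map_mx (@conjc R) v)^T.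
have v'A : v' = skew_mx a *m v'.
  by rewrite /v' {1}vA map_mxN map_mxM linearN /= trmx_mul skew_mx_adj mulNmx opprK.
have : v *m v' = - (v *m v').
  by rewrite {1}vA mulNmx -mulmxA -v'A.
move=> /eqP; rewrite -addr_eq0 -mulr2n -scaler_nat scaler_eq0 pnatr_eq0 /= => /eqP.
move=> /(congr1 (fun M : 'M_1 => M 0 0)); rewrite !mxE => sum0.
apply/rowP => i; rewrite mxE; apply/eqP; rewrite -normr_eq0 -sqrf_eq0 normCK.
have := @psumr_eq0P _ _ _ _ _ sum0 i isT; rewrite !mxE => -> // j _.
by rewrite !mxE -[_ * _]normCK exprn_ge0.
Qed.

(** The adjoint exchanges 1 - A and 1 + A, which commute, so all factors cancel. *)
Lemma unitary_cayley (R : realType) (a : nat -> R) : unitary4 (cayley (skew_mx a)).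
Proof.
have Au : 1%:M + skew_mx a \in unitmx by exact: unitmx_skew.
have adjA := skew_mx_adj a; set A := skew_mx a in Au adjA *.
have adjD : (map_mx (@conjc R) (1%:M + A))^T = 1%:M - A.
  by rewrite map_mxD map_mx1 linearD /= trmx1 adjA.
have adjB : (map_mx (@conjc R) (1%:M - A))^T = 1%:M + A.
  by rewrite map_mxB map_mx1 linearB /= trmx1 adjA opprK.
have Bu : 1%:M - A \in unitmx by rewrite -adjD unitmx_tr map_unitmx.
rewrite /unitary4 /cayley map_mxM trmx_mul adjB map_invmx trmx_inv adjD.
have comm : (1%:M - A) *m invmx (1%:M + A) = invmx (1%:M + A) *m (1%:M - A).
  apply: (canLR (mulmxK Au)); rewrite -mulmxA.
  have -> : (1%:M - A) *m (1%:M + A) = (1%:M + A) *m (1%:M - A).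
    by rewrite mulmxBl mul1mx [A *m _]mulmxDr mulmxBr !mulmx1 mulmxDl mul1mx.
  by rewrite mulmxA mulVmx // mul1mx.
by rewrite comm mulmxA -[X in X *m _]mulmxA mulmxV // mulmx1 mulVmx.
Qed.

(** * Circuits without CNOT as Kronecker products *)

Lemma kron1 (A : comPzSemiRingType) : kron 1%:M 1%:M = 1%:M :> 'M[A]_4.
Proof.
apply/matrixP => i j; rewrite !mxE !inord_eq2 ?ltn_mod ?ltn_divLR // -natrM mulnb.
congr (_%:R); rewrite -val_eqE /=; congr nat_of_bool.
apply/andP/eqP => [[/eqP q /eqP r]|->//].
by rewrite (divn_eq i 2) q r -divn_eq.
Qed.

Lemma det_mx2 (A : comNzRingType) (M : 'M[A]_2) :
  \det M = M 0 0 * M 1 1 - M 0 1 * M 1 0.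
Proof.
rewrite (expand_det_row _ 0) !big_ord_recl big_ord0 addr0 /cofactor !det_mx11 !mxE.
rewrite expr0 mul1r expr1 mulN1r mulrN.
by congr (M _ _ * M _ _ - M _ _ * M _ _); apply/val_inj.
Qed.

Lemma unitmx_Ry (R : realType) (t : R) : Ry t \in unitmx.
Proof.
rewrite unitmxE det_mx2 !mxE /= unitfE; apply/eqP => /eqP.
rewrite eq_complex /= !mul0r !mulr0 !subr0 mulrN opprK -!expr2 cos2Dsin2.
by rewrite oner_eq0.
Qed.

Lemma unitmx_Rz (R : realType) (t : R) : Rz t \in unitmx.
Proof.
rewrite unitmxE det_mx2 !mxE /= mul0r subr0 unitfE; apply/eqP => /eqP.
by rewrite eq_complex /= mulNr opprK -!expr2 cos2Dsin2 oner_eq0.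
Qed.

Lemma local_circuit (R : realType) (c : seq (gate R)) : count (@is_cnot R) c = 0%N ->
  exists A B, [/\ A \in unitmx, B \in unitmx & circuit_mx c = kron A B].
Proof.
elim: c => [|g c IH]; first by exists 1%:M, 1%:M; rewrite !unitmx1 kron1.
move=> /eqP; rewrite addn_eq0 => /andP[gc /eqP /IH[A [B [Au Bu cE]]]].
case: g gc => //= t _; rewrite cE ?kron_leftE ?kron_rightE kron_mulmx mul1mx.
- by exists (Ry t *m A), B; rewrite unitmx_mul unitmx_Ry.
- by exists A, (Ry t *m B); rewrite unitmx_mul unitmx_Ry.
- by exists (Rz t *m A), B; rewrite unitmx_mul unitmx_Rz.
- by exists A, (Rz t *m B); rewrite unitmx_mul unitmx_Rz.
Qed.

(** * A unitary outside every family of at most 14 parameters *)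

Lemma covered_scale (F : fieldType) (p q k l : nat) (S : 'M[F]_q -> Prop) :
  poly_covered p k l S -> poly_covered p k l (fun M => exists2 z, z != 0 & S (z *: M)).
Proof.
move=> [N NP]; exists N => M [z z0 /NP[x [s [s0 xP]]]].
exists x, (s * z); split; first by rewrite mulf_neq0.
by move=> y /xP ->; rewrite scalerA.
Qed.

Lemma generic_unitary (R : realType) :
  exists U : 'M[R[i]]_4, unitary4 U /\
    forall (w : seq piece_kind) (z : R[i]), z != 0 -> pieces w (z *: U) ->
      (14 < pieces_dim w)%N.
Proof.
pose S (w : seq piece_kind) (M : 'M[R[i]]_4) :=
  (pieces_dim w <= 14)%N /\ exists2 z, z != 0 & pieces w (z *: M).
have covS w : poly_covered 15 0 14 (S w).
  have [w14|w14] := leqP (pieces_dim w) 14; last first.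
    (* Beyond 14 parameters [S w] is empty, so any matrix covers it; this gives a relation for every
       word. *)
    by exists 0 => M [] /(leq_trans w14); rewrite ltnn.
  have w15 : (0 + pieces_dim w <= 15)%N by exact: ltnW.
  have [N NP] := covered_scale (covered_pieces R w15).
  exists N => M [_ /NP[x [s [s0 xP]]]]; exists x, s; split=> // y yx.
  by apply: xP => j /= jw; apply: yx; rewrite (leq_trans jw).
pose rel w := cid (svalP (cid (cayley_relation (covS w)))).
(* Words over the finite type [piece_kind] are countable, so one point violates all relations at
   once. *)
have [a aP] := generic_real_point (fun w => (svalP (rel w)).1).
exists (cayley (skew_mx a)); split; first exact: unitary_cayley.
move=> w z z0 wU; rewrite ltnNge; apply/negP => w14.
move/eqP: (aP w); apply; apply: (svalP (rel w)).2; first exact: unitmx_skew.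
by split=> //; exists z.
Qed.

(** * Circuits as words of pieces, and the gate counts *)

Definition gate_kind {R : realType} (g : gate R) : piece_kind :=
  match g with
  | RyA _ => inl (inl (true, true))
  | RyB _ => inl (inl (false, true))
  | RzA _ => inl (inl (true, false))
  | RzB _ => inl (inl (false, false))
  | CNOT1 => inl (inr true)
  | CNOT2 => inl (inr false)
  end.

Lemma piece_gate_kind (R : realType) (g : gate R) : piece (gate_kind g) (gate_mx g).
Proof. by case: g => //= t; exists t. Qed.

Lemma pieces_circuit (R : realType) (c : seq (gate R)) :
  pieces (map gate_kind c) (circuit_mx c).
Proof.
elim: c => //= g c IH; exists (gate_mx g), (circuit_mx c); split=> //.
exact: piece_gate_kind.
Qed.

Lemma pieces_dim_circuit (R : realType) (c : seq (gate R)) :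
  pieces_dim (map gate_kind c) = count (@is_rotation R) c.
Proof. by elim: c => //= g c <-; case: g. Qed.

Lemma circuit_mx_cat (R : realType) (c d : seq (gate R)) :
  circuit_mx (c ++ d) = circuit_mx c *m circuit_mx d.
Proof. by elim: c => [|g c IH] /=; rewrite ?mul1mx // IH mulmxA. Qed.

Lemma unitmx_row_neq0 (F : fieldType) (n : nat) (M : 'M[F]_n) (i : 'I_n) :
  M \in unitmx -> exists j, M i j != 0.
Proof.
move=> Mu; apply/existsP; apply: contraT => /existsPn Mi.
have := congr1 (fun N : 'M_n => N i i) (mulmxV Mu).
rewrite !mxE eqxx big1 => [/eqP|j _]; first by rewrite eq_sym oner_eq0.
by have /negPn/eqP -> := Mi j; rewrite mul0r.
Qed.

Lemma local_piece (R : realType) (c : seq (gate R)) : count (@is_cnot R) c = 0%N ->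
  exists ab, piece (inr ab) (circuit_mx c).
Proof.
move=> /local_circuit[A [B [/(unitmx_row_neq0 0)[a Aa] /(unitmx_row_neq0 0)[b Bb] cE]]].
by exists (a, b), A, B.
Qed.

(** A single CNOT splits the circuit into local parts, which merge into one Kronecker product each:
    6 + 0 + 6 parameters however many rotations there are. *)
Lemma pieces_few_cnot (R : realType) (c : seq (gate R)) :
  (count (@is_cnot R) c <= 1)%N ->
  exists2 w, (pieces_dim w <= 12)%N & pieces w (circuit_mx c).
Proof.
move=> c1; have [hc|nc] := boolP (has (@is_cnot R) c); last first.
  have [|ab cP] := @local_piece R c; first by apply/eqP; rewrite -leqn0 leqNgt -has_count.
  by exists [:: inr ab] => //; exists (circuit_mx c), 1%:M; rewrite mulmx1.
move: c1; case/split_find: hc => g c1 c2 gcnot _.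
rewrite -cats1 -catA !count_cat /= gcnot addn0 addnCA add1n ltnS leqn0 addn_eq0.
case/andP => /eqP /local_piece[ab abP] /eqP /local_piece[ab' abP'].
exists [:: inr ab; gate_kind g; inr ab']; first by case: (g) gcnot.
exists (circuit_mx c1), (gate_mx g *m circuit_mx c2); split=> //; last first.
  by rewrite circuit_mx_cat.
exists (gate_mx g), (circuit_mx c2); split=> //; first exact: piece_gate_kind.
by exists (circuit_mx c2), 1%:M; rewrite mulmx1.
Qed.

Theorem theorem2 (R : realType) :
  exists U : 'M[R[i]]_4,
    unitary4 U /\
    forall c : seq (gate R),
      implements_up_to_phase c U ->
      [/\ (17 <= size c)%N, (15 <= count (@is_rotation R) c)%N
        & (2 <= count (@is_cnot R) c)%N].
Proof.
have [U [Uu UP]] := generic_unitary R; exists U; split=> // c [z [z1 cE]].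
have z0 : z != 0 by rewrite -normr_eq0 z1 oner_eq0.
have rot : (15 <= count (@is_rotation R) c)%N.
  by rewrite -pieces_dim_circuit (UP _ z) // -cE; exact: pieces_circuit.
have cnot : (2 <= count (@is_cnot R) c)%N.
  rewrite ltnNge; apply/negP => /pieces_few_cnot[w w12]; rewrite cE => /(UP _ _ z0).
  by rewrite ltnNge (leq_trans w12).
(* Every gate is a rotation or a CNOT, so the two bounds add up to 15 + 2 = 17. *)
split=> //; rewrite -(count_predC (@is_rotation R)).
rewrite [count (predC _) c](_ : _ = count (@is_cnot R) c).
  exact: (@leq_add 15 2).
by apply: eq_count => -[].
Qed.
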